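(* For all integers $k\ge1$, $j\ge1$ and $N\ge\max\{0,j-k\}$, \[ \sum_{n=0}^{N}\left|\alpha_{n,j}^{(k)}\right|^2>\sum_{n=0}^{N}\left|\alpha_{n,j+1}^{(k)}\right|^2 . \]
   Context: $H^2(\mathbb D^2)$ is the Hardy space over the bidisk, in which the monomials $z^aw^b$ ($a,b\ge0$) form an orthonormal basis. For $k\ge1$ let $p_k=(z-w)^k$ and let $M_k=[p_k]$ be the closure of $p_k\mathbb C[z,w]$ in $H^2(\mathbb D^2)$. For $n\ge0$ let $A^n=\left(\langle p_kz^iw^{n-i},p_kz^jw^{n-j}\rangle\right)_{i,j=0}^n$ (a real symmetric positive definite Toeplitz matrix), let $A^n_{i,j}$ be the algebraic (signed) cofactor of its $(i,j)$ entry (indices from $0$ to $n$; $A^0_{0,0}=1$), and put $D_0=1$, $D_n=\det A^{n-1}$ for $n\ge1$. Set \[ \phi_n=\frac{\sum_{l=0}^nA^n_{0,l}\,p_kz^lw^{n-l}}{\sqrt{D_nD_{n+1}}},\qquad \psi_n=\frac{\sum_{l=0}^nA^n_{n,l}\,p_kz^lw^{n-l}}{\sqrt{D_nD_{n+1}}}\qquad(n\ge0). \] These are orthonormal bases of $M_k\ominus zM_k$ and $M_k\ominus wM_k$ respectively. For $n\ge0$, $j\ge1$ define $\alpha_{n,j}^{(k)}=\langle w^j\phi_n,z^j\psi_n\rangle$. *)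

(* Defs.v *)
From HB Require Import structures.
From mathcomp Require Import all_boot all_order all_algebra.
From mathcomp Require Import mpoly.

Set Implicit Arguments.
Unset Strict Implicit.
Unset Printing Implicit Defensive.

Import Order.TTheory GRing.Theory Num.Theory.

Local Open Scope ring_scope.

(* The polynomials form a dense subspace of H^2(D^2), and every vector below   *)
(* is a polynomial.  As the monomials z^a w^b are orthonormal, the H^2 inner   *)
(* product of f and g is sum_(a, b) f_(a,b) * conj(g_(a,b)); only exponents in *)
(* the support of f contribute.                                                *)
Definition hardy_dot (C : numClosedFieldType) (f g : {mpoly C[2]}) : C :=
  \sum_(m <- msupp f) f@_m * (g@_m)^*.

Definition zvar (C : numClosedFieldType) : {mpoly C[2]} := 'X_ord0.
Definition wvar (C : numClosedFieldType) : {mpoly C[2]} := 'X_ord_max.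

Section ToeplitzBases.

Variables (C : numClosedFieldType) (k : nat).

Local Notation z := (zvar C).
Local Notation w := (wvar C).

Definition pk : {mpoly C[2]} := (z - w) ^+ k.

Definition pk_mon (n l : nat) : {mpoly C[2]} := pk * z ^+ l * w ^+ (n - l).

Definition gram (n : nat) : 'M[C]_n.+1 :=
  \matrix_(i, j) hardy_dot (pk_mon n i) (pk_mon n j).

Definition gram_det (n : nat) : C := if n is m.+1 then \det (gram m) else 1.

Definition phi (n : nat) : {mpoly C[2]} :=
  (sqrtC (gram_det n * gram_det n.+1))^-1 *:
    \sum_(l < n.+1) cofactor (gram n) ord0 l *: pk_mon n l.

Definition psi (n : nat) : {mpoly C[2]} :=
  (sqrtC (gram_det n * gram_det n.+1))^-1 *:
    \sum_(l < n.+1) cofactor (gram n) ord_max l *: pk_mon n l.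

Definition alpha (n j : nat) : C :=
  hardy_dot (w ^+ j * phi n) (z ^+ j * psi n).

End ToeplitzBases.

(* Main.v *)
Require Import Defs.
From HB Require Import structures.
From mathcomp Require Import all_boot all_order all_algebra.
From mathcomp Require Import reals complex.
From mathcomp Require Import ring lra zify mpoly.

Set Implicit Arguments.
Unset Strict Implicit.
Unset Printing Implicit Defensive.

Import Order.TTheory GRing.Theory Num.Theory.

Local Open Scope ring_scope.

(* Identify a form of degree d in z, w with a univariate polynomial of degree   *)
(* at most d.  With T = (x - 1)^k, the first row of cofactors of A^n is         *)
(* proportional to the coefficients of an explicit P_n (the reversed orthogonal *)
(* polynomial for the weight |1 - x|^(2k) on the circle), the last row to those *)
(* of the reversal of P_n, and alpha_(n,j) is, up to normalisation, the         *)
(* coefficient of x^(n+k+j) in (T P_n)^2.  The first-order relations between    *)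
(* P_n and P_(n+1) give, for a_n = alpha_(n,j) and b_n = alpha_(n,j+1),         *)
(*   (n+k+2+j) b_(n+1) + (n+k+1-j) a_(n+1) = (n+k+j) a_n + (n+k+1-j) b_n.       *)
(* If s_n is the right-hand side, s_n^2 / (4 j (n+k+1)) grows by at most        *)
(* a_(n+1)^2 - b_(n+1)^2 at each step, strictly less unless                     *)
(* a_(n+1) = b_(n+1) = 0; summing these differences gives the inequality, which *)
(* is strict because alpha_(max(0,j-k),j) does not vanish.                      *)

(** Reversing [T] only multiplies it by [(-1)^k], so pairing [T x^i] with [T q] reads off the
    coefficient of [x^(k+i)] in [T^2 q]. The required orthogonality is thus the vanishing of the
    middle coefficients of [T^2 P_n] ([coef_szego_gram_eq0]), and Cramer's rule ([mul_cofactor])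
    then identifies both rows of cofactors without evaluating a determinant. The square roots enter
    alpha only through a squared modulus, which [gram_detS] makes rational ([uK]), so every alpha is
    a rational number ([alphaE]).

    [P_n] obeys a raising relation ([szegoS]) and a lowering relation ([deriv_szegoS]). Together
    they express [T^2 P_n P_(n+1)] through the square at [n] and also through the square at [n + 1];
    comparing coefficients gives [alphaqS], and [alphaq0] is its instance [n = -1] with zero
    right-hand side. The inequality follows from these relations by [energy_increment] and
    [energy_lt], with strictness from [alphaq_neq0]. *)

Section Reversal.

Variable R : comNzRingType.
Implicit Types (p q : {poly R}) (d e i k n : nat).

(** This is [x^d p(1/x)], with the part of [p] above degree [d] dropped; hence the size bounds in
    the lemmas below. *)
Definition revp d p : {poly R} := \poly_(e < d.+1) p`_(d - e).

Definition dotp d p q : R := \sum_(e < d.+1) p`_e * q`_e.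

Lemma dotpC d p q : dotp d p q = dotp d q p.
Proof. by apply: eq_bigr => e _; rewrite mulrC. Qed.

Lemma dotpE d p q : dotp d p q = (revp d p * q)`_d.
Proof.
rewrite coefMr; apply: eq_bigr => e _.
by rewrite coef_poly ltnS leq_subr subKn -1?ltnS.
Qed.

Lemma dotp_sumr d p n (a : 'I_n -> R) (q : 'I_n -> {poly R}) :
  dotp d p (\sum_l a l *: q l) = \sum_l dotp d p (q l) * a l.
Proof.
under [RHS]eq_bigr do rewrite mulr_suml.
rewrite exchange_big; apply: eq_bigr => e _.
rewrite coef_sum mulr_sumr; apply: eq_bigr => l _.
by rewrite coefZ mulrA mulrAC.
Qed.

Lemma size_revp d p : (size (revp d p) <= d.+1)%N.
Proof. exact: size_poly. Qed.

Lemma revpK d p : (size p <= d.+1)%N -> revp d (revp d p) = p.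
Proof.
move=> sp; apply/polyP => e; rewrite !coef_poly !ltnS leq_subr.
by case: leqP => ed; [rewrite subKn | rewrite nth_default // (leq_trans sp)].
Qed.

Lemma revp_Xn n i : (i <= n)%N -> revp n 'X^i = 'X^(n - i).
Proof.
move=> lein; apply/polyP => e; rewrite coef_poly !coefXn ltnS.
case: leqP => en; first by congr ((_ : bool)%:R); lia.
by have -> : (e == n - i)%N = false by lia.
Qed.

Lemma revp_mulXn d j p : revp (d + j) ('X^j * p) = revp d p.
Proof.
apply/polyP => e; rewrite !coef_poly coefXnM.
rewrite [(e < d.+1)%N]ltnS; case: (leqP e d) => ed; last first.
  by case: ltnP => // ed1; rewrite ifT //; lia.
have -> : (e < (d + j).+1)%N by lia.
have -> : (d + j - e < j)%N = false by lia.
by congr (_`_ _); lia.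
Qed.

Lemma revp_mulXsub1 d p : (size p <= d.+1)%N ->
  revp d.+1 (('X - 1) * p) = - (('X - 1) * revp d p).
Proof.
move=> sp; apply/polyP => e.
rewrite coefN !mulrBl !mul1r !coef_poly !coefB !coefXM !coef_poly.
case: e => [|e] /=; first by rewrite !subn0 [p`_ d.+1]nth_default //; ring.
rewrite subSS !ltnS subn_eq0 /=; case: (ltngtP e d) => [ed|ed|->].
- by rewrite subnS; ring.
- ring.
- by rewrite subnn ; ring.
Qed.

Lemma size_expXsub1M k n p : (size p <= n.+1)%N ->
  (size (('X - 1 : {poly R}) ^+ k * p)%R <= (n + k).+1)%N.
Proof.
move=> sp; apply: leq_trans (size_polyMleq _ _) _.
have sT : (size (('X - 1 : {poly R}) ^+ k) <= k.+1)%N.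
  by apply: leq_trans (size_exp_leq _ _) _; rewrite size_XsubC mul1n.
by rewrite -subn1 leq_subLR; apply: leq_trans (leq_add sT sp) _; lia.
Qed.

(** Each factor [X - 1] is antipalindromic and contributes one sign. *)
Lemma revp_expXsub1 k n p : (size p <= n.+1)%N ->
  revp (n + k) (('X - 1) ^+ k * p) = (-1) ^+ k *: (('X - 1) ^+ k * revp n p).
Proof.
move=> sp; elim: k => [|k IH]; first by rewrite addn0 !expr0 !mul1r scale1r.
rewrite addnS exprS -mulrA revp_mulXsub1 ?IH.
  by rewrite -scalerAr [in RHS]exprS mulN1r scaleNr !mulrA.
exact: size_expXsub1M.
Qed.

Lemma dotp_expXsub1 k n i q : (i <= n)%N ->
  dotp (n + k) (('X - 1) ^+ k * 'X^i) (('X - 1) ^+ k * q) =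
  (-1) ^+ k * ((('X - 1) ^+ k) ^+ 2 * q)`_(k + i).
Proof.
move=> lein; rewrite dotpE revp_expXsub1 ?size_polyXn // revp_Xn //.
rewrite -scalerAl coefZ; congr (_ * _).
rewrite (_ : _ * _ * _ = 'X^(n - i) * ((('X - 1) ^+ k) ^+ 2 * q)); last by ring.
rewrite coefXnM; have -> : (n + k < n - i)%N = false by lia.
by congr (_`_ _); lia.
Qed.

(** The pairing depends only on the difference of the exponents and is symmetric, so reversing both
    indices preserves it. *)
Lemma dotp_rev k n i l : (i <= n)%N -> (l <= n)%N ->
  dotp (n + k) (('X - 1) ^+ k * 'X^(n - i)) (('X - 1) ^+ k * 'X^(n - l)) =
  dotp (n + k) (('X - 1) ^+ k * 'X^i) (('X - 1) ^+ k * 'X^l).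
Proof.
move=> lein leln; rewrite [RHS]dotpC !dotp_expXsub1 ?leq_subr //.
congr (_ * _); rewrite !coefMXn.
have -> : (k + (n - i) < n - l)%N = (k + l < i)%N by lia.
by case: ifP => // ?; congr (_`_ _); lia.
Qed.

End Reversal.

(** These three lemmas reduce an equation to a certificate: given multipliers for the hypotheses,
    what remains is an identity for [ring]. *)
Lemma linear_combination1 (R : comNzRingType) (x1 l r a1 b1 : R) :
  a1 = b1 -> l - r = x1 * (a1 - b1) -> l = r.
Proof. by move=> -> /eqP; rewrite subrr mulr0 subr_eq0 => /eqP. Qed.

Lemma linear_combination2 (R : comNzRingType) (x1 x2 l r a1 b1 a2 b2 : R) :
  a1 = b1 -> a2 = b2 -> l - r = x1 * (a1 - b1) + x2 * (a2 - b2) -> l = r.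
Proof. by move=> e ->; rewrite subrr mulr0 addr0; apply: linear_combination1. Qed.

Lemma linear_combination3 (R : comNzRingType)
    (x1 x2 x3 l r a1 b1 a2 b2 a3 b3 : R) :
  a1 = b1 -> a2 = b2 -> a3 = b3 ->
  l - r = x1 * (a1 - b1) + x2 * (a2 - b2) + x3 * (a3 - b3) -> l = r.
Proof. by move=> e f ->; rewrite subrr mulr0 addr0; apply: linear_combination2. Qed.

Arguments linear_combination1 {R} x1 {l r a1 b1}.
Arguments linear_combination2 {R} x1 x2 {l r a1 b1 a2 b2}.
Arguments linear_combination3 {R} x1 x2 x3 {l r a1 b1 a2 b2 a3 b3}.

Lemma coef_expXsub1 (R : comNzRingType) m i :
  (('X - 1 : {poly R}) ^+ m)`_i = (-1) ^+ (m + i) * 'C(m, i)%:R.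
Proof.
elim: m i => [|m IH] i.
  by rewrite expr0 coef1; case: i => [|i]; rewrite ?mulr1 ?mulr0.
rewrite exprS mulrBl mul1r coefB coefXM !IH; case: i => [|i] /=.
  by rewrite !bin0 addSn exprS; ring.
by rewrite binS natrD !addnS !addSn !exprS; ring.
Qed.

(** * The polynomials [P_n] and their first-order relations *)

Section OrthogonalPolynomials.

Variable k : nat.

Local Notation T := (('X - 1) ^+ k : {poly rat}).

(** In closed form the coefficient of [x^l] is ['C(n, l) (k)_l (k+1)_(n-l)] with rising factorials;
    the differential recursion is what the proofs use. *)
Fixpoint szego n : {poly rat} :=
  if n is m.+1 then
    (k%:R * 'X + (m + k).+1%:R) * szego m - 'X * (1 - 'X) * (szego m)^`()
  else 1.

Local Notation P := szego.

Lemma szegoS n : P n.+1 =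
  (k%:R * 'X + n%:R + k%:R + 1) * P n - 'X * (1 - 'X) * (P n)^`().
Proof. by rewrite /= -[(n + k).+1%:R]natr1 natrD !addrA. Qed.

Lemma deriv_natr (n : nat) : (n%:R : {poly rat})^`() = 0.
Proof. by rewrite -polyC_natr derivC. Qed.

Let dE := (deriv_natr, derivX, derivD, derivN, derivM, @derivC rat 1).

(** By induction: apply the operator taking [P_n] to [P_(n+1)] to the relation at [n]. The
    multipliers below are the two terms of that operator, followed by the one that turns its value
    on [P_n] into [P_(n+1)]. *)
Lemma deriv_szegoS n :
  (1 - 'X) * (P n.+1)^`() + (n%:R + 1) * P n.+1 =
  ((n%:R + 1) * (k%:R + k%:R + n%:R + 1)) * P n.
Proof.
elim: n => [|n IH]; first by rewrite szegoS [P 0]/= !dE; ring.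
have /(congr1 (fun p => p^`())) := IH.
rewrite [P n.+2]szegoS -![n.+1%:R]natr1; move: IH (szegoS n).
move: (P n) (P n.+1) => p q IH pq.
rewrite !dE => dIH; apply: (linear_combination3 (k%:R * 'X + n%:R + k%:R + 1)
  (- 'X * (1 - 'X)) (- ((n%:R + 1) * (k%:R + k%:R + n%:R + 1))) IH dIH pq).
ring.
Qed.

Definition szego_gram n := T ^+ 2 * P n.
Definition szego_square n := (T * P n) ^+ 2.

Local Notation W := szego_gram.
Local Notation Y := szego_square.

Lemma deriv_expXsub1 : (1 - 'X) * T^`() = - k%:R * T.
Proof.
elim: (k) => [|m IH]; first by rewrite !expr0 dE; ring.
rewrite exprS -[m.+1%:R]natr1 !dE.
apply: (linear_combination1 ('X - 1) IH); ring.
Qed.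

Lemma szego_gramS n :
  W n.+1 = (n%:R + k%:R + 1 - k%:R * 'X) * W n - 'X * (1 - 'X) * (W n)^`().
Proof.
rewrite /W expr2 szegoS !dE; move: deriv_expXsub1; set t := T => dT.
apply: (linear_combination1 (2 * 'X * t * P n) dT); ring.
Qed.

Lemma deriv_szego_gramS n :
  (1 - 'X) * (W n.+1)^`() + (k%:R + k%:R + n%:R + 1) * W n.+1 =
  ((n%:R + 1) * (k%:R + k%:R + n%:R + 1)) * W n.
Proof.
rewrite /W expr2; move: deriv_expXsub1 (deriv_szegoS n); set t := T.
move: (P n) (P n.+1) => p q dT dP; rewrite !dE.
apply: (linear_combination2 (2 * t * q) (t ^+ 2) dT dP); ring.
Qed.

(** Both sides equal [2 (n+1) (2k+n+1) T^2 P_n P_(n+1)]: the left one by the lowering relation, the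
    right one by the raising relation. *)
Lemma deriv_szego_squareS n :
  (1 - 'X) * (Y n.+1)^`() + 2 * (n%:R + k%:R + 1) * Y n.+1 =
  ((n%:R + 1) * (k%:R + k%:R + n%:R + 1)) *
  (2 * (n%:R + k%:R + 1) * Y n - 'X * (1 - 'X) * (Y n)^`()).
Proof.
rewrite /Y !expr2; move: deriv_expXsub1 (deriv_szegoS n) (szegoS n).
set t := T; move: (P n) (P n.+1) => p q dT dP pq; rewrite !dE.
apply: (linear_combination3
  (2 * t * q ^+ 2 + 2 * ((n%:R + 1) * (k%:R + k%:R + n%:R + 1)) * 'X * t * p ^+ 2)
  (2 * t ^+ 2 * q)
  (2 * ((n%:R + 1) * (k%:R + k%:R + n%:R + 1)) * t ^+ 2 * p) dT dP pq); ring.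
Qed.

(** * Coefficient recurrences, orthogonality and positivity *)

Lemma coef_natrM (m : nat) (p : {poly rat}) i : (m%:R * p)`_i = m%:R * p`_i.
Proof. by rewrite mulr_natl coefMn mulr_natl. Qed.

Lemma coefXderiv (p : {poly rat}) i : ('X * p^`())`_i = i%:R * p`_i.
Proof. by rewrite coefXM coef_deriv; case: i => [|i]; rewrite ?mul0r ?mulr_natl. Qed.

Lemma coef_szegoS n i : (P n.+1)`_i.+1 =
  (n%:R + k%:R - i%:R) * (P n)`_i.+1 + (k%:R + i%:R) * (P n)`_i.
Proof.
rewrite szegoS (_ : _ - _ = 'X * (k%:R * P n) + n%:R * P n + k%:R * P n + P n
   - 'X * (P n)^`() + 'X * ('X * (P n)^`())); last by ring.
rewrite !(coefD, coefN) !(coefXderiv, coef_natrM, coefXM) /=.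
by rewrite -[i.+1%:R]natr1; ring.
Qed.

Lemma coef0_szegoS n : (P n.+1)`_0 = (n%:R + k%:R + 1) * (P n)`_0.
Proof.
rewrite szegoS (_ : _ - _ = 'X * (k%:R * P n) + n%:R * P n + k%:R * P n + P n
   - 'X * (P n)^`() + 'X * ('X * (P n)^`())); last by ring.
by rewrite !(coefD, coefN) !(coefXderiv, coef_natrM, coefXM) /=; ring.
Qed.

Lemma coef_szego_gramS n i : (W n.+1)`_i.+1 =
  (n%:R + k%:R - i%:R) * (W n)`_i.+1 + (i%:R - k%:R) * (W n)`_i.
Proof.
rewrite szego_gramS (_ : _ - _ = - ('X * (k%:R * W n)) + n%:R * W n + k%:R * W n
   + W n - 'X * (W n)^`() + 'X * ('X * (W n)^`())); last by ring.
rewrite !(coefD, coefN) !(coefXderiv, coef_natrM, coefXM) /=.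
by rewrite -[i.+1%:R]natr1; ring.
Qed.

Lemma coef_deriv_szego_gramS n i :
  (i%:R + 1) * (W n.+1)`_i.+1 + (k%:R + k%:R + n%:R + 1 - i%:R) * (W n.+1)`_i =
  (n%:R + 1) * (k%:R + k%:R + n%:R + 1) * (W n)`_i.
Proof.
have /(congr1 (fun p : {poly rat} => p`_i)) := deriv_szego_gramS n.
rewrite (_ : _ + _ = (W n.+1)^`() - 'X * (W n.+1)^`() +
    (k + k + n + 1)%:R * W n.+1); last first.
  by rewrite !natrD; ring.
rewrite (_ : _ * W n = ((n + 1) * (k + k + n + 1))%N%:R * W n); last first.
  by rewrite natrM !natrD; ring.
rewrite !(coefD, coefN) !(coefXderiv, coef_natrM) coef_deriv.
rewrite -[_ *+ i.+1]mulr_natl -[i.+1%:R]natr1.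
by rewrite !(natrM, natrD) => <-; ring.
Qed.

Lemma coef_deriv_szego_squareS n i (l := n%:R + k%:R + 1) :
  (i%:R + 2) * (Y n.+1)`_i.+2 + (2 * l - i%:R - 1) * (Y n.+1)`_i.+1 =
  (n%:R + 1) * (k%:R + k%:R + n%:R + 1) *
  ((2 * l - i%:R - 1) * (Y n)`_i.+1 + i%:R * (Y n)`_i).
Proof.
have /(congr1 (fun p : {poly rat} => p`_i.+1)) := deriv_szego_squareS n.
rewrite (_ : _ + _ = (Y n.+1)^`() - 'X * (Y n.+1)^`() +
    (2 * (n + k + 1))%N%:R * Y n.+1); last first.
  by rewrite !(natrM, natrD); ring.
rewrite (_ : _ * (_ - _) = ((n + 1) * (k + k + n + 1))%N%:R *
   ((2 * (n + k + 1))%N%:R * Y n - 'X * (Y n)^`() + 'X * ('X * (Y n)^`()))); last first.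
  by rewrite !(natrM, natrD); ring.
rewrite !(coefD, coefN, coefXderiv, coef_natrM, coefXM) /= coef_deriv.
rewrite -[_ *+ i.+2]mulr_natl.
rewrite -[i.+2%:R]natr1 -[i.+1%:R]natr1.
by rewrite !(natrM, natrD) /l => e; apply: (linear_combination1 1 e); ring.
Qed.

Lemma coef_szego_gram0 i : (W 0)`_i = (-1) ^+ i * 'C(k * 2, i)%:R.
Proof.
rewrite /W mulr1 -exprM coef_expXsub1 exprD mulnC exprM.
by rewrite sqrrN !expr1n mul1r.
Qed.

(** This is the orthogonality of [T P_n] to [T x^i]. In [coef_szego_gramS] the terms outside the
    range of the induction hypothesis carry the factors [i] and [n - i], which vanish at the two
    ends. *)
Lemma coef_szego_gram_eq0 n i : (0 < i <= n)%N -> (W n)`_(k + i) = 0.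
Proof.
elim: n i => [|n IH] [|i] // /andP[_ lin].
rewrite addnS coef_szego_gramS -addnS natrD.
have -> : (k%:R + i%:R - k%:R) * (W n)`_(k + i) = 0.
  case: i lin => [|i] lin; first by rewrite addr0 subrr mul0r.
  by rewrite IH ?mulr0 // ltnW.
move: lin; rewrite addr0 ltnS leq_eqVlt => /predU1P[->|lin].
  by rewrite [n%:R + _]addrC subrr mul0r.
by rewrite IH // mulr0.
Qed.

(** The pairing of [T] with [T P_n], that is, the one nonzero entry of the Gram matrix applied to
    the coefficients of [P_n]. *)
Definition gram_norm n : rat := (-1) ^+ k * (W n)`_k.

Lemma gram_normS n : (k%:R + n%:R + 1) * gram_norm n.+1 =
  (n%:R + 1) * (k%:R + k%:R + n%:R + 1) * gram_norm n.
Proof.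
rewrite /gram_norm; have := coef_deriv_szego_gramS n k.
have := @coef_szego_gram_eq0 n.+1 1 isT; rewrite addn1 => -> e.
by apply: (linear_combination1 ((-1) ^+ k) e); ring.
Qed.

Lemma gram_norm_gt0 n : 0 < gram_norm n.
Proof.
elim: n => [|n IH].
  rewrite /gram_norm coef_szego_gram0 mulrA -expr2 sqrr_sign mul1r.
  by rewrite ltr0n bin_gt0 leq_pmulr.
have : 0 < (k%:R + n%:R + 1) * gram_norm n.+1.
  by rewrite gram_normS; apply: mulr_gt0 IH; rewrite mulr_gt0 ?ltr_wpDl ?addr_ge0.
by rewrite pmulr_rgt0 // ltr_wpDl ?addr_ge0.
Qed.

Lemma coef0_szego_gt0 n : 0 < (P n)`_0.
Proof.
elim: n => [|n IH]; first by rewrite coef1.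
by rewrite coef0_szegoS mulr_gt0 // ltr_wpDl ?addr_ge0.
Qed.

Lemma size_szego n : (size (P n) <= n.+1)%N.
Proof.
elim: n => [|n /leq_sizeP IH]; first by rewrite size_poly1.
apply/leq_sizeP => -[|i] // ltni.
rewrite coef_szegoS (IH i.+1) ?mulr0 ?add0r; last by lia.
by rewrite (IH i) ?mulr0.
Qed.

Lemma lead_szego_neq0 n : (0 < k)%N -> (P n)`_n != 0.
Proof.
move=> k0; elim: n => [|n IH]; first by rewrite coef1.
have /leq_sizeP sz := size_szego n.
by rewrite coef_szegoS sz // mulr0 add0r mulf_neq0 // -natrD pnatr_eq0; lia.
Qed.

(** The rational value of alpha, as [alphaE] confirms. *)
Definition alphaq n j : rat :=
  (-1) ^+ k * (Y n)`_(n + k + j) / (gram_norm n * (P n)`_0).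

Lemma alphaqS n j :
  (n%:R + k%:R + j%:R + 2) * alphaq n.+1 j.+1 +
    (n%:R + k%:R + 1 - j%:R) * alphaq n.+1 j =
  (n%:R + k%:R + j%:R) * alphaq n j + (n%:R + k%:R + 1 - j%:R) * alphaq n j.+1.
Proof.
have h0 := lt0r_neq0 (gram_norm_gt0 n).
have c0 := lt0r_neq0 (coef0_szego_gt0 n).
have n1 : n%:R + 1 != 0 :> rat by rewrite natr1 pnatr_eq0.
have k1 : k%:R + k%:R + n%:R + 1 != 0 :> rat by rewrite -!natrD natr1 pnatr_eq0.
(* The normalising denominators grow by exactly the constant factor in [coef_deriv_szego_squareS],
   so that factor cancels. *)
have HS : gram_norm n.+1 * (P n.+1)`_0 =
   (n%:R + 1) * (k%:R + k%:R + n%:R + 1) * (gram_norm n * (P n)`_0).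
  by rewrite coef0_szegoS [RHS]mulrA -gram_normS; ring.
have := coef_deriv_szego_squareS n (n + k + j); rewrite /alphaq HS.
rewrite !addSn !addnS !natrD; set y0 := (Y n)`__; set y1 := (Y n)`__.
set y3 := (Y n.+1)`__; set y2 := (Y n.+1)`__ => e.
rewrite [LHS](_ : _ = (-1) ^+ k * ((n%:R + k%:R + j%:R + 2) * y3 +
   (2 * (n%:R + k%:R + 1) - (n%:R + k%:R + j%:R) - 1) * y2) /
   ((n%:R + 1) * (k%:R + k%:R + n%:R + 1) * (gram_norm n * (P n)`_0)));
  last by ring.
by rewrite e; field; rewrite h0 c0 n1 k1.
Qed.

(** At [n = 0] the square is [(x - 1)^(2k)], so this is the ratio of consecutive binomial
    coefficients. *)
Lemma alphaq0 j :
  (k%:R + j%:R + 1) * alphaq 0 j.+1 + (k%:R - j%:R) * alphaq 0 j = 0.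
Proof.
have : (1 - 'X) * (Y 0)^`() = - (k%:R + k%:R) * Y 0.
  rewrite /Y mulr1 expr2 dE; move: deriv_expXsub1; set t := T => dT.
  by apply: (linear_combination1 (2 * t) dT); ring.
move/(congr1 (fun p : {poly rat} => p`_(k + j))).
rewrite (_ : _ * _ = (Y 0)^`() - 'X * (Y 0)^`()); last by ring.
rewrite (_ : _ * _ = - ((k + k)%N%:R * Y 0)); last by rewrite natrD; ring.
rewrite !(coefD, coefN, coefXderiv, coef_natrM) coef_deriv.
rewrite -[_ *+ (k + j).+1]mulr_natl.
rewrite -[(k + j).+1%:R]natr1 !natrD /alphaq !add0n addnS.
move=> e.
by apply: (linear_combination1 ((-1) ^+ k / (gram_norm 0 * (P 0)`_0)) e); ring.
Qed.

Lemma alphaq_neq0 j : (0 < k)%N -> alphaq (j - k) j != 0.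
Proof.
move=> k0; rewrite /alphaq; apply: mulf_neq0; last first.
  by rewrite invr_eq0 mulf_neq0 // lt0r_neq0 // (coef0_szego_gt0, gram_norm_gt0).
apply: mulf_neq0; first by rewrite signr_eq0.
case: (leqP j k) => [ljk|ltkj].
  have -> : (j - k = 0)%N by lia.
  rewrite /Y mulr1 -exprM coef_expXsub1 mulf_neq0 ?signr_eq0 //.
  by rewrite pnatr_eq0 -lt0n bin_gt0; lia.
(* The exponent is now the degree of [(T P_n)^2], so the coefficient is its leading one. *)
set n := (j - k)%N; have -> : (n + k + j = (n + k) * 2)%N by lia.
have P0 : P n != 0.
  by apply: contra_neq (lead_szego_neq0 n k0) => ->; rewrite coef0.
have sP : size (P n) = n.+1.
  apply/eqP; rewrite eqn_leq size_szego ltnNge.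
  apply/negP => /leq_sizeP/(_ n (leqnn n)).
  exact/eqP/lead_szego_neq0.
have sTP : (size (T * P n)).-1 = (n + k)%N.
  rewrite size_monicM ?monic_exp ?monicXsubC // size_exp_XsubC sP.
  by rewrite addSn addnS addnC.
rewrite -sTP -size_exp -lead_coefE lead_coef_eq0.
by rewrite expf_neq0 // mulf_neq0 // expf_neq0 // polyXsubC_eq0.
Qed.

End OrthogonalPolynomials.

(** * The energy inequality for the two-sequence recurrence *)

Section Energy.

Variable F : realFieldType.

(** With [m = n + k], the two sides of the recurrence make [sg] the quantity arriving from step
    [n - 1] and [sg'] the one passed on to step [n + 1]. *)
Lemma energy_increment (m j a b : F) (sg := (m + 1 + j) * b + (m - j) * a)
    (sg' := (m + j) * a + (m + 1 - j) * b) : 0 < m -> 0 < j ->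
  sg' ^+ 2 / (4 * j * (m + 1)) - sg ^+ 2 / (4 * j * m) <= a ^+ 2 - b ^+ 2
    ?= iff ((a == 0) && (b == 0)).
Proof.
move=> m0 j0.
(* The defect is a quadratic form in p and q; completing the square in p gives G. *)
pose M := 2 * m + 1; pose p := a + b; pose q := a - b.
pose K := M ^+ 2 * (8 * j * m + (2 * j + 1) ^+ 2) - (M + 2 * j) ^+ 2.
pose G := (M ^+ 2 * p - (M + 2 * j) * q) ^+ 2 + q ^+ 2 * K.
have M0 : 0 < M by rewrite /M; lra.
have K0 : 0 < K.
  (* Difference of squares: [M (2j + 1) - (M + 2j) = 2j (M - 1) = 4jm]. *)
  rewrite /K /M (_ : _ - _ = (2 * m + 1) ^+ 2 * (8 * j * m) +
    4 * j * m * (2 * (2 * m + 1) + 2 * j * (2 * m + 1) + 2 * j)); last by ring.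
  by rewrite addr_gt0 ?mulr_gt0 ?exprn_gt0 //; nra.
have G0 : 0 <= G by rewrite addr_ge0 ?sqr_ge0 // mulr_ge0 ?sqr_ge0 // ltW.
have -> : sg' ^+ 2 / (4 * j * (m + 1)) - sg ^+ 2 / (4 * j * m) =
    a ^+ 2 - b ^+ 2 - G / (4 * M ^+ 2 * (4 * j * m * (m + 1))).
  rewrite /G /K /M /sg /sg' /p /q; field.
  by do ![apply/andP; split]; apply/eqP => e; nra.
have d0 : 0 < 4 * M ^+ 2 * (4 * j * m * (m + 1)).
  by rewrite !mulr_gt0 ?exprn_gt0 //; lra.
split; first by rewrite lerBlDr lerDl divr_ge0 // ltW.
rewrite -subr_eq0 addrAC subrr add0r oppr_eq0 mulf_eq0 invr_eq0 (gt_eqF d0) orbF.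
rewrite paddr_eq0 ?sqr_ge0 //; last by rewrite mulr_ge0 ?sqr_ge0 // ltW.
rewrite [q ^+ 2 * K == 0]mulf_eq0 (gt_eqF K0) orbF !sqrf_eq0.
apply/andP/andP => [[/eqP e /eqP q0]|[/eqP a0 /eqP b0]]; last first.
  by rewrite /p /q a0 b0 !addr0 subr0 !mulr0 subr0 eqxx.
move: e; rewrite q0 mulr0 subr0 => /eqP; rewrite mulf_eq0 sqrf_eq0 (gt_eqF M0) /=.
by move: q0; rewrite /q /p => q0 /eqP p0; split; apply/eqP; lra.
Qed.

Lemma energy_lt (k j N n0 : nat) (a b : nat -> F) :
    (0 < k)%N -> (0 < j)%N -> (n0 <= N)%N -> a n0 != 0 ->
    (k%:R + j%:R + 1) * b 0 + (k%:R - j%:R) * a 0 = 0 ->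
    (forall n,
       (n%:R + k%:R + j%:R + 2) * b n.+1 + (n%:R + k%:R + 1 - j%:R) * a n.+1 =
       (n%:R + k%:R + j%:R) * a n + (n%:R + k%:R + 1 - j%:R) * b n) ->
  \sum_(n < N.+1) b n ^+ 2 < \sum_(n < N.+1) a n ^+ 2.
Proof.
move=> k0 j0 n0N an0 base rec.
pose sg n := (n%:R + k%:R + j%:R) * a n + (n%:R + k%:R + 1 - j%:R) * b n.
pose E n := sg n ^+ 2 / (4 * j%:R * (n%:R + k%:R + 1)).
have kF : 0 < k%:R :> F by rewrite ltr0n.
have jF : 0 < j%:R :> F by rewrite ltr0n.
(* Here [m = k], and [base] says that the incoming energy is zero, so the telescoping sum starts
   with [E 0] itself and totals [E N >= 0]. *)
have E0 : E 0 <= a 0 ^+ 2 - b 0 ^+ 2 ?= iff ((a 0 == 0) && (b 0 == 0)).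
  have := energy_increment (a 0) (b 0) kF jF.
  by rewrite /= [k%:R + 1 + j%:R]addrAC base expr0n mul0r subr0 /E /sg !add0r.
have ES n : E n.+1 - E n <= a n.+1 ^+ 2 - b n.+1 ^+ 2
    ?= iff ((a n.+1 == 0) && (b n.+1 == 0)).
  have m0 : 0 < n%:R + k%:R + 1 :> F by rewrite ltr_wpDl ?addr_ge0.
  have := energy_increment (a n.+1) (b n.+1) m0 jF.
  rewrite /E /sg -(rec n) -[n.+1%:R]natr1 /= [n%:R + 1 + k%:R]addrAC.
  by rewrite (_ : n%:R + k%:R + 1 + 1 + j%:R = n%:R + k%:R + j%:R + 2) //; ring.
rewrite -subr_gt0 -sumrB.
pose D n := if n is n'.+1 then E n - E n' else E 0.
have DE : \sum_(n < N.+1) D n = E N.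
  elim: N {n0N} => [|N IH]; first by rewrite big_ord1.
  by rewrite big_ord_recr /= IH addrC subrK.
have leD : \sum_(n < N.+1) D n <= \sum_(n < N.+1) (a n ^+ 2 - b n ^+ 2)
    ?= iff [forall n : 'I_N.+1, (a n == 0) && (b n == 0)].
  by apply: leif_sum => -[[|n] ltn] _; [exact: E0 | exact: ES].
apply: (@le_lt_trans _ _ (E N)).
  by rewrite divr_ge0 ?sqr_ge0 ?mulr_ge0 ?addr_ge0.
rewrite -DE (lt_leif leD); apply/negP => /forallP/(_ (Ordinal (n0N : n0 < N.+1)%N)).
by rewrite /= (negPf an0).
Qed.

End Energy.

(** * Homogeneous forms and the Hardy inner product *)

Section HardyProduct.

Variable C : numClosedFieldType.

Local Notation z := (zvar C).
Local Notation w := (wvar C).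

Lemma hardy_dot_wide (s : seq 'X_{1..2}) (f g : {mpoly C[2]}) :
  uniq s -> {subset msupp f <= s} ->
  hardy_dot f g = \sum_(m <- s) f@_m * (g@_m)^*.
Proof.
move=> us fs; rewrite /hardy_dot (perm_big [seq m <- s | m \in msupp f]) /=.
  by rewrite big_filter big_rmcond // => m /memN_msupp_eq0 ->; rewrite mul0r.
apply: uniq_perm; rewrite ?msupp_uniq ?filter_uniq // => m.
by rewrite mem_filter; case: (boolP (m \in _)) => // /fs ->.
Qed.

Lemma hardy_dotZ (a b : C) (f g : {mpoly C[2]}) :
  hardy_dot (a *: f) (b *: g) = a * b^* * hardy_dot f g.
Proof.
rewrite (@hardy_dot_wide (msupp f)) ?msupp_uniq //; last exact: msuppZ_le.
rewrite /hardy_dot mulr_sumr; apply: eq_bigr => m _.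
by rewrite !mcoeffZ rmorphM; ring.
Qed.

Lemma conj_ratr (x : rat) : (ratr x : C)^* = ratr x.
Proof. exact: (fmorph_rat Num.conj). Qed.

Definition bimon e f : 'X_{1..2} := (U_(ord0) *+ e + U_(ord_max) *+ f)%MM.

Lemma bimonE e f : z ^+ e * w ^+ f = 'X_[bimon e f].
Proof. by rewrite mpolyXD !mpolyXn. Qed.

Lemma bimon0 e f : bimon e f ord0 = e.
Proof. by rewrite mnmDE !mulmnE !mnm1E /= mul1n mul0n addn0. Qed.

(** Coefficients of [q] above degree [d] are dropped, which is why multiplication by [w] carries a
    size bound. *)
Definition homogenize d (q : {poly rat}) : {mpoly C[2]} :=
  \sum_(e < d.+1) ratr q`_e *: (z ^+ e * w ^+ (d - e)).

Lemma mcoeff_homogenize d q m :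
  (homogenize d q)@_m = \sum_(e < d.+1) ratr q`_e * (bimon e (d - e) == m)%:R.
Proof.
rewrite [LHS]raddf_sum; apply: eq_bigr => e _.
by rewrite /= mcoeffZ bimonE mcoeffX.
Qed.

Lemma hardy_dot_homogenize d p q :
  hardy_dot (homogenize d p) (homogenize d q) = ratr (dotp d p q).
Proof.
pose s := [seq bimon e (d - e) | e : 'I_d.+1 <- enum 'I_d.+1].
have bI : injective (fun e : 'I_d.+1 => bimon e (d - e)).
  move=> e f /(congr1 (fun m : 'X_{1..2} => m ord0)).
  by rewrite !bimon0 => /val_inj.
have cf (r : {poly rat}) (e : 'I_d.+1) :
    (homogenize d r)@_(bimon e (d - e)) = ratr r`_e.
  rewrite mcoeff_homogenize (bigD1 e) //= eqxx mulr1 big1 ?addr0 // => f nfe.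
  by rewrite (inj_eq bI) (negPf nfe) mulr0.
rewrite (@hardy_dot_wide s).
- rewrite big_map big_enum rmorph_sum; apply: eq_bigr => e _ /=.
  by rewrite !cf conj_ratr rmorphM.
- by rewrite (map_inj_uniq bI) enum_uniq.
move=> m; rewrite mcoeff_msupp; apply: contraR => /mapP ms.
rewrite mcoeff_homogenize big1 // => e _; case: eqP => [e1|]; last by rewrite mulr0.
by case: ms; exists e; rewrite ?mem_enum.
Qed.

Lemma homogenize_sum d n (a : 'I_n -> rat) (q : 'I_n -> {poly rat}) :
  homogenize d (\sum_l a l *: q l) = \sum_l ratr (a l) *: homogenize d (q l).
Proof.
under [RHS]eq_bigr do rewrite scaler_sumr.
rewrite exchange_big; apply: eq_bigr => e _ /=.
rewrite coef_sum rmorph_sum scaler_suml; apply: eq_bigr => l _.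
by rewrite coefZ rmorphM scalerA.
Qed.

Lemma homogenizeB d p q : homogenize d (p - q) = homogenize d p - homogenize d q.
Proof.
by rewrite /homogenize -sumrB; apply: eq_bigr => e _; rewrite coefB rmorphB scalerBl.
Qed.

Lemma homogenize0 : homogenize 0 1 = 1.
Proof. by rewrite /homogenize big_ord1 coef1 rmorph1 scale1r !expr0 mulr1. Qed.

Lemma mulz_homogenize d q : z * homogenize d q = homogenize d.+1 ('X * q).
Proof.
rewrite [RHS]big_ord_recl coefXM /= rmorph0 scale0r add0r mulr_sumr.
apply: eq_bigr => e _; rewrite coefXM /= -scalerAr; congr (_ *: _).
by rewrite exprS mulrA.
Qed.

Lemma mulw_homogenize d (q : {poly rat}) :
  (size q <= d.+1)%N -> w * homogenize d q = homogenize d.+1 q.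
Proof.
move=> sq; rewrite [RHS]big_ord_recr /= nth_default // rmorph0 scale0r addr0 mulr_sumr.
apply: eq_bigr => e _; rewrite -scalerAr; congr (_ *: _).
by rewrite subSn -1?ltnS // exprS mulrCA.
Qed.

Lemma mulzX_homogenize j d q : z ^+ j * homogenize d q = homogenize (d + j) ('X^j * q).
Proof.
elim: j => [|j IH]; first by rewrite !expr0 !mul1r addn0.
by rewrite exprS -mulrA IH mulz_homogenize addnS mulrA -exprS.
Qed.

Lemma mulwX_homogenize j d (q : {poly rat}) :
  (size q <= d.+1)%N -> w ^+ j * homogenize d q = homogenize (d + j) q.
Proof.
move=> sq; elim: j => [|j IH]; first by rewrite !expr0 mul1r addn0.
by rewrite exprS -mulrA IH mulw_homogenize ?addnS // (leq_trans sq) // ltnS leq_addr.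
Qed.

Lemma mulpk_homogenize k d (q : {poly rat}) : (size q <= d.+1)%N ->
  pk C k * homogenize d q = homogenize (d + k) (('X - 1) ^+ k * q).
Proof.
move=> sq; elim: k => [|k IH]; first by rewrite /pk !expr0 !mul1r addn0.
rewrite /pk exprS -mulrA IH mulrBl mulz_homogenize mulw_homogenize.
  by rewrite -homogenizeB addnS exprS -[in RHS]mulrA mulrBl mul1r.
exact: size_expXsub1M.
Qed.

Lemma pk_monE k n l : (l <= n)%N ->
  pk_mon C k n l = homogenize (n + k) (('X - 1) ^+ k * 'X^l).
Proof.
move=> ln; rewrite /pk_mon -mulrA -[w ^+ _]mulr1 -homogenize0.
rewrite mulwX_homogenize ?size_poly1 //.
by rewrite mulzX_homogenize mulr1 mulpk_homogenize ?size_polyXn ?add0n subnK.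
Qed.

End HardyProduct.

(** Cramer's rule: multiply the hypothesis by the adjugate, whose column [i] lists the cofactors of
    row [i]. *)
Lemma mul_cofactor (R : comNzRingType) n (A : 'M[R]_n) (i : 'I_n)
    (h : R) (c : 'cV_n) l :
  A *m c = h *: delta_mx i ord0 -> h * cofactor A i l = \det A * c l ord0.
Proof.
move=> Ac; have /(congr1 (fun M : 'cV_n => M l ord0)) := congr1 (mulmx (\adj A)) Ac.
rewrite mulmxA mul_adj_mx mul_scalar_mx -scalemxAr -colE !mxE => ->.
by rewrite mulrC.
Qed.

(** * Identification of phi, psi and alpha with the polynomial data *)

Section Bridge.

Variables (C : numClosedFieldType) (k : nat).

Local Notation T := (('X - 1) ^+ k : {poly rat}).
Local Notation P := (szego k).
Local Notation gram := (gram C k).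
Local Notation gram_det := (gram_det C k).

Lemma gramE n (i l : 'I_n.+1) :
  gram n i l = ratr (dotp (n + k) (T * 'X^i) (T * 'X^l)).
Proof. by rewrite mxE !pk_monE ?hardy_dot_homogenize ?leq_ord. Qed.

Lemma sum_mulXn n (q : {poly rat}) : (size q <= n.+1)%N ->
  \sum_(l < n.+1) q`_l *: (T * 'X^l) = T * q.
Proof.
move=> sq; under eq_bigr do rewrite scalerAr.
by rewrite -mulr_sumr -poly_def -/(take_poly _ _) take_poly_id.
Qed.

Lemma gram_mul_szego n :
  gram n *m (\col_l ratr (P n)`_l) = ratr (gram_norm k n) *: delta_mx ord0 ord0.
Proof.
apply/matrixP => i j; rewrite ord1 !mxE eqxx andbT.
under eq_bigr do rewrite gramE mxE -rmorphM.
rewrite -rmorph_sum -dotp_sumr sum_mulXn ?size_szego // dotp_expXsub1 ?leq_ord //=.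
case: (eqVneq i ord0) => [->|i0]; first by rewrite addn0 mulr1.
rewrite [_`_ _]coef_szego_gram_eq0 ?mulr0 ?rmorph0 // lt0n leq_ord andbT; exact: i0.
Qed.

(** A symmetric Toeplitz matrix is unchanged when both indices are reversed, so this is
    [gram_mul_szego] read backwards. *)
Lemma gram_mul_rev_szego n :
  gram n *m (\col_l ratr (P n)`_(n - l)) =
  ratr (gram_norm k n) *: delta_mx ord_max ord0.
Proof.
apply/matrixP => i j; have /matrixP/(_ (rev_ord i) j) := gram_mul_szego n.
rewrite ord1 !mxE (can2_eq rev_ordK rev_ordK).
have -> : rev_ord ord0 = ord_max :> 'I_n.+1 by apply: val_inj; rewrite /= subn1.
move=> <-; rewrite [RHS](reindex_inj rev_ord_inj); apply: eq_bigr => l _.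
by rewrite !gramE !mxE /= !subSS dotp_rev ?leq_ord.
Qed.

Lemma cofactor0_gram n l :
  ratr (gram_norm k n) * cofactor (gram n) ord0 l = \det (gram n) * ratr (P n)`_l.
Proof. by rewrite (mul_cofactor _ (gram_mul_szego n)) mxE. Qed.

Lemma cofactor_max_gram n l :
  ratr (gram_norm k n) * cofactor (gram n) ord_max l =
  \det (gram n) * ratr (P n)`_(n - l).
Proof. by rewrite (mul_cofactor _ (gram_mul_rev_szego n)) mxE. Qed.

(** Deleting the first row and column of a Toeplitz matrix leaves the smaller Toeplitz matrix, so
    the corner cofactor of [gram n] is [gram_det n]. *)
Lemma gram_detS n :
  ratr (gram_norm k n) * gram_det n = gram_det n.+1 * ratr (P n)`_0.
Proof.
rewrite -[in RHS](cofactor0_gram ord0) /cofactor expr0 mul1r; congr (_ * _).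
case: n => [|n]; first by rewrite det_mx00.
congr (\det _); apply/matrixP => i l; rewrite [RHS]mxE [RHS]mxE !gramE.
rewrite !dotp_expXsub1 ?leq_ord // !lift0 addnS -addSn.
by rewrite !coefMXn addSn ltnS subSS.
Qed.

Lemma gram_det_gt0 n : 0 < gram_det n.
Proof.
elim: n => [|n IH]; first exact: ltr01.
have : 0 < gram_det n.+1 * ratr (P n)`_0.
  by rewrite -gram_detS mulr_gt0 // ltr0q gram_norm_gt0.
by rewrite pmulr_lgt0 // ltr0q coef0_szego_gt0.
Qed.

Let u n : C := (sqrtC (gram_det n * gram_det n.+1))^-1 *
  (gram_det n.+1 / ratr (gram_norm k n)).

(** The scalar is real, so this is its square, and [gram_detS] cancels the ratio of determinants
    that survives. *)
Lemma uK n : u n * (u n)^* = ratr (gram_norm k n * (P n)`_0)^-1.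
Proof.
have D0 := gram_det_gt0 n; have D1 := gram_det_gt0 n.+1.
have h0 : 0 < ratr (gram_norm k n) :> C by rewrite ltr0q gram_norm_gt0.
have c0 : 0 < ratr (P n)`_0 :> C by rewrite ltr0q coef0_szego_gt0.
have /conj_Creal -> : u n \is Num.real.
  by rewrite ger0_real // mulr_ge0 ?invr_ge0 ?sqrtC_ge0 ?mulr_ge0 ?invr_ge0 // ltW.
rewrite -expr2 /u exprMn exprVn sqrtCK fmorphV (rmorphM _ (gram_norm k n)).
have -> : gram_det n = gram_det n.+1 * ratr (P n)`_0 / ratr (gram_norm k n).
  by rewrite -gram_detS mulrAC mulfV ?mul1r // gt_eqF.
by field; rewrite !gt_eqF.
Qed.

Lemma phiE n : phi C k n = u n *: homogenize C (n + k) (T * P n).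
Proof.
rewrite /phi -(sum_mulXn (size_szego k n)) homogenize_sum -scalerA; congr (_ *: _).
rewrite scaler_sumr; apply: eq_bigr => l _.
rewrite pk_monE ?leq_ord // scalerA; congr (_ *: _).
have h0 : ratr (gram_norm k n) != 0 :> C.
  by rewrite fmorph_eq0 lt0r_neq0 ?gram_norm_gt0.
by apply: (mulfI h0); rewrite cofactor0_gram /=; field.
Qed.

Lemma psiE n : psi C k n = u n *: homogenize C (n + k) (T * revp n (P n)).
Proof.
rewrite /psi -(sum_mulXn (size_revp n (P n))) homogenize_sum -scalerA; congr (_ *: _).
rewrite scaler_sumr; apply: eq_bigr => l _.
rewrite pk_monE ?leq_ord // scalerA; congr (_ *: _).
have h0 : ratr (gram_norm k n) != 0 :> C.
  by rewrite fmorph_eq0 lt0r_neq0 ?gram_norm_gt0.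
by apply: (mulfI h0); rewrite cofactor_max_gram coef_poly ltn_ord /=; field.
Qed.

(** Reversing the factor that comes from [z^j psi] absorbs [X^j] and undoes the reversal of [P_n],
    leaving [(-1)^k T P_n] against [T P_n]; the shift by [j] survives only in the exponent read
    off. *)
Lemma alphaE n j : alpha C k n j = ratr (alphaq k n j).
Proof.
rewrite /alpha phiE psiE -!scalerAr hardy_dotZ uK.
have sT (q : {poly rat}) :
    (size q <= n.+1)%N -> (size (T * q)%R <= (n + k).+1)%N.
  exact: size_expXsub1M.
rewrite mulwX_homogenize ?sT ?size_szego // mulzX_homogenize hardy_dot_homogenize.
rewrite -rmorphM dotpC dotpE revp_mulXn revp_expXsub1 ?size_revp //.
rewrite revpK ?size_szego //.
by rewrite -scalerAl coefZ -expr2 mulrC.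
Qed.

End Bridge.

(* N >= max{0, j - k} is (j - k <= N)%N because subtraction on nat truncates. *)
Theorem theorem4p2 (R : realType) (k j N : nat)
    (k_ge1 : (1 <= k)%N) (j_ge1 : (1 <= j)%N) (leN : (j - k <= N)%N) :
  \sum_(n < N.+1) `|alpha R[i] k n j| ^+ 2 >
  \sum_(n < N.+1) `|alpha R[i] k n j.+1| ^+ 2.
Proof.
have sumE i : \sum_(n < N.+1) `|alpha R[i] k n i| ^+ 2 =
    ratr (\sum_(n < N.+1) alphaq k n i ^+ 2).
  rewrite rmorph_sum; apply: eq_bigr => n _.
  by rewrite alphaE -normrX -rmorphXn ger0_norm // ler0q sqr_ge0.
rewrite !sumE ltr_rat.
apply: (@energy_lt _ k j N (j - k) (alphaq k ^~ j) (alphaq k ^~ j.+1)) => //.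
- exact: alphaq_neq0.
- exact: alphaq0.
by move=> n; apply: alphaqS.
Qed.
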